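(* For every $m\ge4$ and $s\ge1$ there exists a hypergenerated stratified Lie algebra of rank $m$ and step $s$.
   Context: A stratified Lie algebra of step $s$ is a finite-dimensional real nilpotent Lie algebra with a decomposition $\mathfrak g=V_1\oplus\dots\oplus V_s$ such that $[V_1,V_i]=V_{i+1}$ for $1\le i\le s-1$, $V_s\ne\{0\}$, $[V_1,V_s]=\{0\}$; its rank is $m=\dim V_1$. It is hypergenerated if every linear subspace $P\subseteq V_1$ with $\dim P=m-1$ satisfies $[\mathfrak g,\mathfrak g]\subseteq\mathrm{Lie}(P)$, where $\mathrm{Lie}(P)$ is the smallest Lie subalgebra of $\mathfrak g$ containing $P$. *)

(* Defs.v *)
From HB Require Import structures.
From mathcomp Require Import all_boot all_order all_algebra.
From mathcomp Require Import all_classical all_reals.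

Set Implicit Arguments.
Unset Strict Implicit.
Unset Printing Implicit Defensive.

Import GRing.Theory.

Local Open Scope ring_scope.
Local Open Scope classical_set_scope.

HB.mixin Record isLieAlgebra (K : fieldType) g of Vector K g := {
  lie_br : g -> g -> g;
  lie_br_linearl : forall y : g, linear (lie_br^~ y);
  lie_br_linearr : forall x : g, linear (lie_br x);
  lie_br_alt : forall x : g, lie_br x x = 0;
  lie_br_jacobi : forall x y z : g,
    lie_br x (lie_br y z) + lie_br y (lie_br z x) + lie_br z (lie_br x y) = 0
}.

#[short(type="lieAlgType")]
HB.structure Definition LieAlgebra (K : fieldType) :=
  { g of Vector K g & isLieAlgebra K g }.

Section LieAlgebra.
Variables (K : fieldType) (g : lieAlgType K).
Implicit Types (U W P : {vspace g}) (V : nat -> {vspace g}) (s : nat).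

(* [U, W] is the span of all brackets; by bilinearity those of basis vectors
   suffice, see [lie_prod_subP]. *)
Definition lie_prod U W : {vspace g} :=
  <<[seq lie_br u w | u <- vbasis U, w <- vbasis W]>>%VS.

Lemma mem_lie_prod U W u w : u \in U -> w \in W -> lie_br u w \in lie_prod U W.
Proof.
pose bl y := GRing.isLinear.Build K g g *:%R (lie_br^~ y) (lie_br_linearl y).
pose br x := GRing.isLinear.Build K g g *:%R (lie_br x) (lie_br_linearr x).
pose fl y : {linear g -> g} := HB.pack (lie_br^~ y) (bl y).
pose fr x : {linear g -> g} := HB.pack (lie_br x) (br x).
move=> /coord_vbasis -> /coord_vbasis ->.
rewrite -[lie_br _ _]/(fl _ _) linear_sum rpred_sum // => i _.
rewrite linearZ rpredZ //= -[lie_br _ _]/(fr _ _) linear_sum rpred_sum // => j _.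
by rewrite linearZ rpredZ //= memv_span // allpairs_f // memt_nth.
Qed.

Lemma lie_prod_subP U W P :
  reflect {in U & W, forall u w, lie_br u w \in P} (lie_prod U W <= P)%VS.
Proof.
apply: (iffP idP) => [sP u w uU wW | brP].
  by apply: subvP sP _ _; exact: mem_lie_prod.
apply/span_subvP => _ /allpairsP[[u w] /= [uU wW ->]].
by apply: brP; exact: vbasis_mem.
Qed.

Definition lie_subalgebra U : Prop := {in U &, forall x y, lie_br x y \in U}.

Definition lie_gen P : set g :=
  \bigcap_(W in [set W : {vspace g} | lie_subalgebra W /\ (P <= W)%VS]) [set` W].

Fixpoint lower_central n : {vspace g} :=
  if n is n'.+1 then lie_prod fullv (lower_central n') else fullv.

Definition lie_nilpotent : Prop := exists n, lower_central n = 0%VS.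

(* Layers are numbered from 1, so that [V i] is V_i; the values [V i] with
   i = 0 or i > s play no role. *)
Record stratification s V : Prop := {
  strat_nilpotent : lie_nilpotent;
  strat_full : (\sum_(i < s) V i.+1)%VS = fullv;
  strat_direct : directv (\sum_(i < s) V i.+1)%VS;
  strat_step : forall i, (1 <= i < s)%N -> lie_prod (V 1%N) (V i) = V i.+1;
  strat_top_neq0 : V s <> 0%VS;
  strat_top : lie_prod (V 1%N) (V s) = 0%VS
}.

Definition strat_rank V : nat := \dim (V 1%N).

Definition hypergenerated V : Prop :=
  forall P, (P <= V 1%N)%VS -> (\dim P).+1 = strat_rank V ->
    [set` lie_prod fullv fullv] `<=` lie_gen P.

End LieAlgebra.

(* Main.v *)
From HB Require Import structures.
Require Import Defs.
From mathcomp Require Import all_boot all_order all_algebra.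
From mathcomp Require Import all_classical all_reals.
From mathcomp Require Import ring lra.

(** Take the complex filiform algebra with basis X, Y_1, ..., Y_s and
  [X, Y_i] = Y_(i+1), regard it as a real Lie algebra, and add an abelian
  factor R^(m-4) to the first layer.  Let P be a real hyperplane of V_1.  It
  contains some p whose X-component x is a nonzero complex number, and then
  ad_p maps the first layer onto V_2, and V_i onto V_(i+1) for i >= 2.
  Only V_2 in Lie(P) needs care.  If i p is not in P, then V_1 = P + R i p and
  [p, i p] = 0, so V_2 = [p, V_1] = [p, P].  If i p is in P, choose a nonzero
  p' = h Y_1 in P; then [p, p'] = x h Y_2 and [i p, p'] = i x h Y_2 span V_2. *)

Set Implicit Arguments.
Unset Strict Implicit.
Unset Printing Implicit Defensive.

Import GRing.Theory.

Local Open Scope ring_scope.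

Lemma hyperplane_decomp (K : fieldType) (E : vectType K) (P U : {vspace E})
    (u v : E) :
  (P <= U)%VS -> (\dim P).+1 = \dim U -> u \in U -> u \notin P -> v \in U ->
  exists c : K, v - c *: u \in P.
Proof.
move=> PU dP uU uP vU.
suff UE : (P + <[u]>)%VS = U.
  move: vU; rewrite -UE => /memv_addP[w wP [_ /vlineP[c ->] ->]].
  by exists c; rewrite addrK.
apply/eqP; rewrite eqEdim subv_add PU -memvE uU -dP /=.
rewrite ltn_neqAle dimvS ?addvSl // andbT.
apply: contra uP => /eqP dE.
have /eqP -> : P == (P + <[u]>)%VS by rewrite eqEdim addvSl dE leqnn.
by rewrite memvE addvSr.
Qed.

(** * The Lie algebra and its bracket *)

Section ComplexFiliform.
Variables (R : realFieldType) (m s : nat).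

(* [(x, (a, b))] stands for (x_0 + i x_1) X + sum_k (a_k + i b_k) Y_(k+1), plus
   the element of the abelian factor given by the coordinates x_2, x_3, ... *)
Definition cfiliform : Type :=
  ('rV[R]_m.+2 * ('rV[R]_s.+1 * 'rV[R]_s.+1))%type.

HB.instance Definition _ := Vector.on cfiliform.

Implicit Types (u v w : cfiliform) (a b : 'rV[R]_s.+1) (p : pred nat).

Lemma inord_pred (k : 'I_s.+1) : (inord k.-1 : 'I_s.+1) = k.-1 :> nat.
Proof. by rewrite inordK // (leq_ltn_trans (leq_pred _)). Qed.

(** This is ad X on the Y-part; the guard is needed because [0.-1] is [0]. *)
Definition shift a : 'rV[R]_s.+1 :=
  \row_k (if k == 0 :> nat then 0 else a 0 (inord k.-1)).

(** A right inverse of [shift] on rows with zero entry 0; the guard is needed because [inord] sends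
    an index out of range to 0. *)
Definition unshift a : 'rV[R]_s.+1 :=
  \row_k (if (k.+1 < s.+1)%N then a 0 (inord k.+1) else 0).

(** With z = x_0 + i x_1 and y = a + i b, this is the shift of z(u) y(v) - z(v) y(u). *)
Definition br u v : cfiliform :=
  (0, (shift (u.1 0 0 *: v.2.1 - u.1 0 1 *: v.2.2
              - (v.1 0 0 *: u.2.1 - v.1 0 1 *: u.2.2)),
       shift (u.1 0 0 *: v.2.2 + u.1 0 1 *: v.2.1
              - (v.1 0 0 *: u.2.2 + v.1 0 1 *: u.2.1)))).

Lemma cfiliform_eqP u v :
  u.1 = v.1 -> (forall k, u.2.1 0 k = v.2.1 0 k) ->
  (forall k, u.2.2 0 k = v.2.2 0 k) -> u = v.
Proof.
case: u v => [x [a b]] [x' [a' b']] /= -> ea eb.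
by congr (_, (_, _)); apply/rowP.
Qed.

Fact br_linearl v : linear (br^~ v).
Proof.
move=> c u w; apply: cfiliform_eqP => [|k|k] /=; first by rewrite scaler0 addr0.
  by rewrite !mxE; case: ifP => _; ring.
by rewrite !mxE; case: ifP => _; ring.
Qed.

Fact br_linearr u : linear (br u).
Proof.
move=> c v w; apply: cfiliform_eqP => [|k|k] /=; first by rewrite scaler0 addr0.
  by rewrite !mxE; case: ifP => _; ring.
by rewrite !mxE; case: ifP => _; ring.
Qed.

Fact br_alt u : br u u = 0.
Proof.
apply: cfiliform_eqP => [|k|k] //=.
  by rewrite !mxE; case: ifP => _; ring.
by rewrite !mxE; case: ifP => _; ring.
Qed.

(** Brackets have no X-component, so the first double bracket is z(u) times the twice shifted z(v)
    y(w) - z(w) y(v), and the cyclic sum cancels. *)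
Fact br_jacobi u v w : br u (br v w) + br v (br w u) + br w (br u v) = 0.
Proof.
apply: cfiliform_eqP => [|k|k] /=; first by rewrite !addr0.
  by rewrite !mxE; case: ifP => _; [ring|case: ifP => _; ring].
by rewrite !mxE; case: ifP => _; [ring|case: ifP => _; ring].
Qed.

HB.instance Definition _ := isLieAlgebra.Build R cfiliform
  br_linearl br_linearr br_alt br_jacobi.

(** * The grading *)

Definition restr p v : cfiliform :=
  (if p 0 then v.1 else 0,
   (\row_k (if p k then v.2.1 0 k else 0),
    \row_k (if p k then v.2.2 0 k else 0))).

Fact restr_linear p : linear (restr p).
Proof.
move=> c u v; apply: cfiliform_eqP => [|k|k] /=.
- by case: (p 0) => //; rewrite scaler0 addr0.
- by rewrite !mxE; case: ifP => _ //; ring.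
- by rewrite !mxE; case: ifP => _ //; ring.
Qed.

HB.instance Definition _ p :=
  GRing.isLinear.Build R cfiliform cfiliform *:%R (restr p) (restr_linear p).

Definition supp p : {vspace cfiliform} := fixedSpace (linfun (restr p)).

(* X and the abelian factor have degree 0, like Y_1. *)
Lemma suppP p v :
  reflect ((~~ p 0 -> v.1 = 0) /\
           (forall k : 'I_s.+1, ~~ p k -> v.2.1 0 k = 0 /\ v.2.2 0 k = 0))
          (v \in supp p).
Proof.
rewrite /supp; apply: (iffP fixedSpaceP); rewrite lfunE /=.
  case: v => [x [a b]] [ex ea eb]; split=> [|k] /= /negPf pk.
    by rewrite pk in ex.
  by rewrite -ea -eb !mxE pk.
case=> ev1 ev2; apply: cfiliform_eqP => [|k|k] /=.
- by case: ifP => // /negbT /ev1.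
- by rewrite mxE; case: ifP => // /negbT /ev2[].
- by rewrite mxE; case: ifP => // /negbT /ev2[].
Qed.

Lemma restr_supp p v : restr p v \in supp p.
Proof.
apply/suppP; split=> [|k] /= /negPf pk; first by rewrite pk.
by rewrite !mxE pk.
Qed.

Lemma restr_id p v : v \in supp p -> restr p v = v.
Proof. by move/fixedSpaceP; rewrite lfunE. Qed.

Lemma restr_disjoint p q v :
  (forall k, p k -> ~~ q k) -> v \in supp q -> restr p v = 0.
Proof.
move=> pq /suppP[v1 v2]; apply: cfiliform_eqP => [|k|k] /=.
- by case: ifP => // /pq /v1.
- by rewrite !mxE; case: ifP => // /pq /v2[].
- by rewrite !mxE; case: ifP => // /pq /v2[].
Qed.

(** Layers are numbered from 1, degrees from 0. *)
Definition layer (i : nat) : {vspace cfiliform} := supp (pred1 i.-1).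

(** [leq n] selects the degrees at least [n]. For [n = 0] it suffices that [shift] kills entry 0;
    for [n > 0] the X-component of [v] vanishes, which leaves only z(u) y(v). *)
Lemma br_supp_leq n u v : v \in supp (leq n) -> br u v \in supp (leq n.+1).
Proof.
move=> /suppP[v1 v2]; apply/suppP; split=> // k /=; rewrite -ltnNge => kn.
rewrite !mxE; case: ifPn => // k0.
have {}kn : (k.-1 < n)%N by move: kn; rewrite ltnS; case: (k : nat) k0.
have kE := inord_pred k.
have [|-> ->] := v2 (inord k.-1); first by rewrite /= kE -ltnNge.
by rewrite v1 ?mxE; [split; ring | rewrite -ltnNge (leq_ltn_trans _ kn)].
Qed.

Lemma br_layer i u v :
  u \in layer 1 -> v \in layer i.+1 -> br u v \in layer i.+2.
Proof.
move=> /suppP[_ u2] /suppP[v1 v2]; apply/suppP; split=> // k /= ki.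
rewrite !mxE; case: ifPn => // k0.
have kE := inord_pred k.
have [|-> ->] := v2 (inord k.-1).
  by rewrite /= kE; move: ki; case: (k : nat) k0.
(* For [i = 0] both Y-parts sit in degree 0; for [i > 0] the term z(v) y(u) vanishes. *)
have [i0|i0] := eqVneq i 0%N.
  have [|-> ->] := u2 (inord k.-1); last by split; ring.
  by rewrite /= kE; move: ki; rewrite i0; case: (k : nat) k0.
have -> : v.1 = 0 by apply: v1; rewrite /= eq_sym.
by rewrite !mxE; split; ring.
Qed.

(** * Inverting ad at an element with nonzero X-component *)

Definition sqnorm u : R := u.1 0 0 ^+ 2 + u.1 0 1 ^+ 2.

(* Division of the Y-part by the complex number x_0 + i x_1, after lowering
   the indices of the Y_i. *)
Definition adinv u v : cfiliform :=
  (0, ((u.1 0 0 / sqnorm u) *: unshift v.2.1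
       + (u.1 0 1 / sqnorm u) *: unshift v.2.2,
       (u.1 0 0 / sqnorm u) *: unshift v.2.2
       - (u.1 0 1 / sqnorm u) *: unshift v.2.1)).

(** As [adinv u v] has no X-component, [br u] multiplies its Y-part by z(u) and shifts it, undoing
    the division; [unshift] drops only entry 0, which is zero by hypothesis. *)
Lemma adinvK u v :
  sqnorm u != 0 -> v \in supp (leq 1) -> br u (adinv u v) = v.
Proof.
move=> nu /suppP[v1 v2].
have H (k : 'I_s.+1) : k != 0 :> nat ->
    ((inord k.-1 : 'I_s.+1).+1 < s.+1)%N /\
    inord (inord k.-1 : 'I_s.+1).+1 = k.
  by move=> k0; rewrite inord_pred prednK ?lt0n // inord_val.
apply: cfiliform_eqP => [|k|k] /=; first by rewrite v1.
  rewrite !mxE; case: ifPn => [/eqP k0|/H[-> ->]].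
    by have [] := v2 k; rewrite ?k0.
  by rewrite /sqnorm; field.
rewrite !mxE; case: ifPn => [/eqP k0|/H[-> ->]].
  by have [] := v2 k; rewrite ?k0.
by rewrite /sqnorm; field.
Qed.

Lemma adinv_layer i u v : v \in layer i.+2 -> adinv u v \in layer i.+1.
Proof.
move=> /suppP[_ v2]; apply/suppP; split=> // k /= ki.
rewrite !mxE; case: ifPn => [ks|_]; last by split; ring.
have [|-> ->] := v2 (inord k.+1); first by rewrite /= inordK.
by split; ring.
Qed.

Lemma layer_leq1 i v : v \in layer i.+2 -> v \in supp (leq 1).
Proof.
move=> /suppP[v1 v2]; apply/suppP; split=> [_|k /=]; first exact: v1.
by rewrite lt0n negbK => /eqP k0; apply: v2; rewrite /= k0.
Qed.

(** * The stratification and its rank *)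

Lemma layer_big : layer s.+2 = 0%VS.
Proof.
apply/eqP; rewrite -subv0; apply/subvP => v /suppP[v1 v2]; rewrite memv0.
apply/eqP/cfiliform_eqP => [|k|k] /=; first exact: v1.
  by have [|->] := v2 k; rewrite ?mxE //= neq_ltn ltn_ord.
by have [|_ ->] := v2 k; rewrite ?mxE //= neq_ltn ltn_ord.
Qed.

Definition genX : cfiliform := (delta_mx 0 0, 0).

Lemma lie_prod_layer i : lie_prod (layer 1) (layer i.+1) = layer i.+2.
Proof.
apply/eqP; rewrite eqEsubv; apply/andP; split.
  by apply/lie_prod_subP => u v; exact: br_layer.
apply/subvP => v vi.
have nX : sqnorm genX != 0 by rewrite /sqnorm !mxE /=; apply/eqP; lra.
rewrite -(adinvK nX (layer_leq1 vi)).
apply: mem_lie_prod; last exact: adinv_layer.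
by apply/suppP; split=> // k _; rewrite !mxE.
Qed.

Lemma sum_restr v : v = \sum_(i < s.+1) restr (pred1 (i : nat)) v.
Proof.
have E1 (f : 'I_s.+1 -> cfiliform) : (\sum_i f i).1 = \sum_i (f i).1.
  by apply: (big_morph (fun u : cfiliform => u.1)).
have E2 (f : 'I_s.+1 -> cfiliform) : (\sum_i f i).2 = \sum_i (f i).2.
  by apply: (big_morph (fun u : cfiliform => u.2)).
have E3 (f : 'I_s.+1 -> 'rV[R]_s.+1 * 'rV[R]_s.+1) :
    (\sum_i f i).1 = \sum_i (f i).1 by apply: (big_morph fst).
have E4 (f : 'I_s.+1 -> 'rV[R]_s.+1 * 'rV[R]_s.+1) :
    (\sum_i f i).2 = \sum_i (f i).2 by apply: (big_morph snd).
apply: cfiliform_eqP => [|k|k].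
- rewrite E1 (bigD1 ord0) //= big1 ?addr0 // => i i0.
  by rewrite eq_sym -val_eqE /= in i0 *; rewrite (negPf i0).
- rewrite E2 E3 summxE (bigD1 k) //= mxE eqxx big1 ?addr0 // => i ik.
  by rewrite mxE val_eqE eq_sym (negPf ik).
- rewrite E2 E4 summxE (bigD1 k) //= mxE eqxx big1 ?addr0 // => i ik.
  by rewrite mxE val_eqE eq_sym (negPf ik).
Qed.

Lemma cfiliform_stratification : stratification s.+1 layer.
Proof.
split.
- have lcP n : (lower_central cfiliform n <= supp (leq n))%VS.
    elim: n => [|n IHn] /=; first by apply/subvP => v _; apply/suppP.
    apply/lie_prod_subP => u v _ /(subvP IHn); exact: br_supp_leq.
  exists s.+1; apply/eqP; rewrite -subv0; apply/subvP => v.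
  move=> /(subvP (lcP _))/suppP[v1 v2]; rewrite memv0.
  apply/eqP/cfiliform_eqP => [|k|k] /=; first exact: v1.
    by have [|->] := v2 k; rewrite ?mxE //= -ltnNge.
  by have [|_ ->] := v2 k; rewrite ?mxE //= -ltnNge.
- apply/eqP; rewrite eqEsubv subvf; apply/subvP => v _.
  rewrite (sum_restr v); apply: memv_sumr => i _; exact: restr_supp.
- apply/directv_sum_independent => u uV u0 i _.
  (* Projecting the vanishing sum to degree [i] isolates [u i]. *)
  have <- : restr (pred1 (i : nat)) (\sum_(j < s.+1) u j) = u i.
    rewrite linear_sum (bigD1 i) //= (restr_id (uV i isT)).
    rewrite big1 ?addr0 // => j ji.
    apply: restr_disjoint (uV j isT) => k /= /eqP ->.
    by rewrite val_eqE eq_sym.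
  by rewrite u0 linear0.
- by move=> [|i] // _; exact: lie_prod_layer.
(* The last generator Y_(s+1) witnesses the top layer; the step is [s.+1] here. *)
- pose w : cfiliform := (0, (delta_mx 0 ord_max, 0)).
  have : w \in layer s.+1.
    apply/suppP; split=> // k /= ks; rewrite !mxE /=; split=> //.
    by rewrite -val_eqE /= (negPf ks).
  move=> wV V0; move: wV; rewrite V0 memv0 => /eqP /(congr1 (fun u => u.2.1)).
  by move=> /rowP/(_ ord_max); rewrite !mxE !eqxx /= => /eqP; rewrite oner_eq0.
- by rewrite lie_prod_layer layer_big.
Qed.

(** The layer is parametrised by m + 2 real coordinates for X and the abelian factor, and two for
    the complex coefficient of Y_1. *)
Lemma dim_layer1 : \dim (layer 1) = m.+4.
Proof.
pose f (q : 'rV[R]_m.+2 * 'rV[R]_2) : cfiliform :=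
  (q.1, (q.2 0 0 *: delta_mx 0 0, q.2 0 1 *: delta_mx 0 0)).
have f_lin : linear f.
  move=> c u v; apply: cfiliform_eqP => [|k|k] //=; rewrite !mxE; ring.
pose fL : {linear _ -> cfiliform} :=
  HB.pack f (GRing.isLinear.Build _ _ _ _ f f_lin).
have kf : lker (linfun fL) == 0%VS.
  apply/lker0P => q q'; rewrite !lfunE /= => -[e1 e2 e3].
  move: q q' e1 e2 e3 => [x a] [x' a'] /= -> /rowP/(_ 0) e2 /rowP/(_ 0) e3.
  move: e2 e3; rewrite !mxE !eqxx !mulr1 => e2 e3; congr (_, _).
  apply/rowP => -[[|[|//]] k].
    by rewrite (_ : Ordinal k = 0) //; apply: val_inj.
  by rewrite (_ : Ordinal k = 1) //; apply: val_inj.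
have -> : layer 1 = limg (linfun fL).
  apply/eqP; rewrite eqEsubv; apply/andP; split; apply/subvP => v.
    move=> /suppP[_ v2].
    have -> : v = linfun fL
        (v.1, \row_k (if k == 0 then v.2.1 0 0 else v.2.2 0 0)).
      rewrite lfunE; apply: cfiliform_eqP => [|k|k] //=; rewrite !mxE /=.
        have [->|k0] := eqVneq k 0; first by rewrite mulr1.
        by rewrite mulr0; have [] := v2 k k0.
      have [->|k0] := eqVneq k 0; first by rewrite mulr1.
      by rewrite mulr0; have [] := v2 k k0.
    exact: memv_img (memvf _).
  move=> /memv_imgP[q _ ->]; rewrite lfunE; apply/suppP; split=> // k /= k0.
  by rewrite !mxE /= -val_eqE /= (negPf k0) !mulr0.
rewrite limg_dim_eq; last by rewrite (eqP kf) capv0.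
by rewrite dimvf -[dim _]/(1 * m.+2 + 1 * 2)%N !mul1n addn2.
Qed.

(** * Hyperplanes of the first layer *)

Definition genY (c d : R) : cfiliform :=
  (0, (c *: delta_mx 0 0, d *: delta_mx 0 0)).

(** Multiplication by i on the complex filiform factor; the abelian factor is sent to 0. *)
Definition mulI u : cfiliform :=
  (- u.1 0 1 *: delta_mx 0 0 + u.1 0 0 *: delta_mx 0 1, (- u.2.2, u.2.1)).

Lemma mulI_layer i u : u \in layer i.+1 -> mulI u \in layer i.+1.
Proof.
move=> /suppP[u1 u2]; apply/suppP; split=> /= [i0|k /u2[]].
  by rewrite u1 // !mxE oppr0 !scale0r addr0.
by rewrite !mxE => -> ->; rewrite oppr0.
Qed.

(** The bracket is complex bilinear and ignores the abelian factor, so this is i [u, u]. *)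
Lemma br_mulI u : br u (mulI u) = 0.
Proof.
apply: cfiliform_eqP => [|k|k] //=; rewrite !mxE /=; case: ifP => _ //; ring.
Qed.

Section Hyperplane.
Variable P : {vspace cfiliform}.
Hypotheses (PV : (P <= layer 1)%VS) (dP : (\dim P).+1 = \dim (layer 1)).

(** If X is not in [P], then [P] contains i X - c X for some real c, and i - c is nonzero. *)
Lemma hyperplane_sqnorm : exists2 u, u \in P & sqnorm u != 0.
Proof.
have XV : genX \in layer 1 by apply/suppP; split=> // k _; rewrite !mxE.
have [XP|XP] := boolP (genX \in P).
  by exists genX => //; rewrite /sqnorm !mxE /=; apply/eqP; lra.
have [c cP] := hyperplane_decomp PV dP XV XP (mulI_layer XV).
exists (mulI genX - c *: genX) => //.
rewrite /sqnorm !mxE /=; apply/eqP; nra.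
Qed.

(** A hyperplane must meet the real plane spanned by Y_1 and i Y_1 outside 0. *)
Lemma hyperplane_genY : exists c d, genY c d \in P /\ c ^+ 2 + d ^+ 2 != 0.
Proof.
have YV c d : genY c d \in layer 1.
  apply/suppP; split=> // k /= k0.
  by rewrite !mxE /= -val_eqE /= (negPf k0) !mulr0.
have [YP|YP] := boolP (genY 1 0 \in P).
  by exists 1, 0; split=> //; apply/eqP; lra.
have [c cP] := hyperplane_decomp PV dP (YV 1 0) YP (YV 0 1).
exists (- c), 1; split; last by apply/eqP; nra.
suff -> : genY (- c) 1 = genY 0 1 - c *: genY 1 0 by [].
by apply: cfiliform_eqP => [|k|k] /=; [rewrite scaler0 subr0|rewrite !mxE; ring..].
Qed.

Lemma hyperplane_layer2 (W : {vspace cfiliform}) :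
  lie_subalgebra W -> (P <= W)%VS -> (layer 2 <= W)%VS.
Proof.
move=> Wbr /subvP PW; apply/subvP => v vV.
have [u uP u0] := hyperplane_sqnorm.
have uV := subvP PV _ uP.
have vK := adinvK u0 (layer_leq1 vV).
have [iuP|iuP] := boolP (mulI u \in P); last first.
  (* Subtracting a multiple of [mulI u] moves the preimage of [v] into [P] without changing its
     bracket with [u]. *)
  have [c cP] := hyperplane_decomp PV dP (mulI_layer uV) iuP (adinv_layer u vV).
  suff <- : lie_br u (adinv u v - c *: mulI u) = v by apply: Wbr; apply: PW.
  transitivity (br u (- c *: mulI u + adinv u v)).
    by rewrite scaleNr addrC.
  by rewrite br_linearr br_mulI scaler0 add0r.
have [c [d [YP cd]]] := hyperplane_genY.
pose w := adinv u v.
(* Here al + i be is the Y_1-coefficient of [w] divided by c + i d. *)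
pose al := (c * w.2.1 0 0 + d * w.2.2 0 0) / (c ^+ 2 + d ^+ 2).
pose be := (c * w.2.2 0 0 - d * w.2.1 0 0) / (c ^+ 2 + d ^+ 2).
suff -> : v = al *: lie_br u (genY c d) + be *: lie_br (mulI u) (genY c d).
  by rewrite rpredD // rpredZ //; apply: Wbr; apply: PW.
suff wE : w = al *: genY c d + be *: mulI (genY c d).
  rewrite -vK -/w wE br_linearr; congr (_ + _).
  (* By complex bilinearity, [u, i y] = [i u, y] for y = [genY c d]. *)
  apply: cfiliform_eqP => [|k|k] /=; first by rewrite scaler0.
    by rewrite !mxE /=; case: ifP => _; rewrite ?mulr0 //; ring.
  by rewrite !mxE /=; case: ifP => _; rewrite ?mulr0 //; ring.
have /suppP[_ w2] : w \in layer 1 by exact: adinv_layer.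
have w1 : w.1 = 0 by [].
clearbody w.
apply: cfiliform_eqP => [|k|k] /=.
- by rewrite w1 !mxE oppr0 !scale0r addr0 !scaler0 addr0.
- rewrite !mxE /=; have [->|k0] := eqVneq k 0; first by rewrite /al /be !mulr1n; field.
  by have [-> _] := w2 k k0; rewrite !mulr0n; ring.
- rewrite !mxE /=; have [->|k0] := eqVneq k 0; first by rewrite /al /be !mulr1n; field.
  by have [_ ->] := w2 k k0; rewrite !mulr0n; ring.
Qed.

(** The preimage [adinv u v] lies one layer lower, hence in [W] by induction; the base is layer 2,
    as [W] need not contain the first layer. *)
Lemma hyperplane_layer (W : {vspace cfiliform}) i :
  lie_subalgebra W -> (P <= W)%VS -> (layer i.+2 <= W)%VS.
Proof.
move=> Wbr PW; elim: i => [|i IHi]; first exact: hyperplane_layer2.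
apply/subvP => v vV; have [u uP u0] := hyperplane_sqnorm.
rewrite -(adinvK u0 (layer_leq1 vV)); apply: Wbr; first exact: subvP PW _ uP.
exact: subvP IHi _ (adinv_layer u vV).
Qed.

End Hyperplane.

Lemma cfiliform_hypergenerated : hypergenerated layer.
Proof.
move=> P PV dP v /= vgg W [Wbr PW] /=.
(* The case [n = 0] of [br_supp_leq] puts the derived algebra in degrees at least 1. *)
have {vgg} /suppP[v1 v2] : v \in supp (leq 1).
  apply: subvP vgg; apply/lie_prod_subP => u w _ _.
  by apply: br_supp_leq; apply/suppP.
(* The degree 0 component vanishes; the component of degree [i.+1] lies in [layer i.+2]. *)
rewrite (sum_restr v) big_ord_recl rpredD ?rpred_sum // => [|i _].
  suff -> : restr (pred1 0%N) v = 0 by rewrite mem0v.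
  apply: (restr_disjoint (q := leq 1)); last exact/suppP.
  by move=> k /eqP ->.
by apply: (subvP (hyperplane_layer PV dP i Wbr PW)); exact: restr_supp.
Qed.

End ComplexFiliform.

Theorem proposition3p20 (R : realType) (m s : nat) (hm : (4 <= m)%N) (hs : (1 <= s)%N) :
  exists (g : lieAlgType R) (V : nat -> {vspace g}),
    [/\ stratification s V, strat_rank V = m & hypergenerated V].
Proof.
case: s hs => // s _; case: m hm => [|[|[|[|m]]]] // _.
(* The parameters are now the rank minus 4 and the step minus 1. *)
exists (cfiliform R m s), (layer R m s); split.
- exact: cfiliform_stratification.
- exact: dim_layer1.
- exact: cfiliform_hypergenerated.
Qed.
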